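(* Let $X\sim\mathcal{GNB\text{-}BE}(m,\beta,\theta=e^{-\lambda},a,b,c)$ be a generalized negative binomial-beta exponential distribution, i.e. $X\mid\lambda\sim\mathcal{GNB}(m,\beta,\theta=e^{-\lambda})$ and $\lambda\mid a,b,c\sim\mathcal{BE}(a,b,c)$. Then the probability mass function of $X$ is given by $$p(x)=\frac{m}{m+\beta x}\binom{m+\beta x}{x}\sum_{j=0}^{x}\binom{x}{j}(-1)^{j}\,\frac{B\!\left(b+\frac{j+m+\beta x-x}{c},\,a\right)}{B(a,b)},\qquad x=0,1,2,\dots,$$ with $m>0$, $\beta\ge 1$ and $a,b,c>0$.
   Context: For $r,s>0$, $B(r,s)=\frac{\Gamma(r)\Gamma(s)}{\Gamma(r+s)}$. For real $y$ and integer $x\ge 0$, $\binom{y}{x}=\frac{y(y-1)\cdots(y-x+1)}{x!}$. The generalized negative binomial distribution $\mathcal{GNB}(m,\beta,\theta)$ has probability mass function $$\frac{m}{m+\beta x}\binom{m+\beta x}{x}(1-\theta)^{x}\theta^{m+\beta x-x},\qquad x=0,1,2,\dots,$$ where $m>0$, $0\le\theta<1$, $\theta\beta<1$ and $\beta\ge 1$. The beta exponential distribution $\mathcal{BE}(a,b,c)$, where $a,b,c>0$, has density $$g(x)=\frac{c}{B(a,b)}e^{-bcx}\left[1-e^{-cx}\right]^{a-1},\qquad x>0.$$ The distribution $\mathcal{GNB\text{-}BE}(m,\beta,\theta=e^{-\lambda},a,b,c)$, also written $\mathcal{GNB\text{-}BE}(m,\beta,a,b,c)$, is the mixture defined by the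 stochastic representation $X\mid\lambda\sim\mathcal{GNB}(m,\beta,\theta=e^{-\lambda})$, $\lambda\mid a,b,c\sim\mathcal{BE}(a,b,c)$. *)

(* Defs.v *)
From HB Require Import structures.
From mathcomp Require Import all_boot all_order all_algebra.
From mathcomp Require Import all_classical all_reals all_analysis.
Set Implicit Arguments.
Unset Strict Implicit.
Unset Printing Implicit Defensive.
Import Order.TTheory GRing.Theory Num.Theory.
Import numFieldNormedType.Exports.
Local Open Scope classical_set_scope.
Local Open Scope ring_scope.

(* The real-valued integral is a junk 0 when it diverges; it converges for
   [0 < r], the only case in which [Gamma] is meaningful here. *)
Definition Gamma (R : realType) (r : R) : R :=
  \int[@lebesgue_measure R]_(t in `]0%R, +oo[) (t `^ (r - 1) * expR (- t)).

Definition Beta (R : realType) (r s : R) : R :=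
  Gamma r * Gamma s / Gamma (r + s).

Definition gbinom (R : realType) (y : R) (x : nat) : R :=
  (\prod_(i < x) (y - i%:R)) / x`!%:R.

Definition gnb_pmf (R : realType) (m beta theta : R) (x : nat) : R :=
  m / (m + beta * x%:R) * gbinom (m + beta * x%:R) x
  * (1 - theta) ^+ x * theta `^ (m + beta * x%:R - x%:R).

(* Total mass 1 requires [(1 - theta) * beta <= 1]; otherwise the law is
   defective (total mass < 1), which is why it is not packaged as a
   [probability]. *)
Definition gnb_law (R : realType) (m beta theta : R) (U : set nat) : \bar R :=
  (\esum_(k in U) (gnb_pmf m beta theta k)%:E)%E.

Definition be_pdf (R : realType) (a b c : R) (x : R) : R :=
  if 0 < x then
    c / Beta a b * expR (- (b * c * x)) * (1 - expR (- (c * x))) `^ (a - 1)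
  else 0.

Definition be_law (R : realType) (a b c : R) (V : set R) : \bar R :=
  (\int[@lebesgue_measure R]_(x in V) (be_pdf a b c x)%:E)%E.

(* The mixture of the laws GNB(m, beta, exp(-l)) over l ~ BE(a, b, c); the
   mixing law is carried by the positive half-line. *)
Definition gnb_be_law (R : realType) (m beta a b c : R) (U : set nat)
    : \bar R :=
  (\int[@lebesgue_measure R]_(l in `]0%R, +oo[)
     (gnb_law m beta (expR (- l)) U * (be_pdf a b c l)%:E))%E.

Definition has_law d d' (T : measurableType d) (T' : measurableType d')
    (R : realType) (P : probability T R) (Y : {RV P >-> T'})
    (nu : set T' -> \bar R) : Prop :=
  forall A, measurable A -> distribution P Y A = nu A.

(* [K l] is the conditional law of [X] given [L = l]. *)
Definition has_cond_law d d1 d2 (T : measurableType d)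
    (T1 : measurableType d1) (T2 : measurableType d2)
    (R : realType) (P : probability T R)
    (X : {RV P >-> T1}) (L : {RV P >-> T2})
    (K : T2 -> set T1 -> \bar R) : Prop :=
  forall (A : set T2) (U : set T1), measurable A -> measurable U ->
    P (L @^-1` A `&` X @^-1` U) = (\int[P]_(w in L @^-1` A) K (L w) U)%E.

(* Main.v *)
Require Import Defs.
From HB Require Import structures.
From mathcomp Require Import all_boot all_order all_algebra.
From mathcomp Require Import all_classical all_reals all_analysis.
From mathcomp Require Import measurable_realfun ring.
Import Order.TTheory GRing.Theory Num.Theory.
Import numFieldNormedType.Exports.
Local Open Scope classical_set_scope.
Local Open Scope ring_scope.

(** Given lambda = l, the probability of x is a constant in l times
    (1 - e^-l)^x e^-(l (m + beta x - x)).  Expanding the binomial (1 - e^-l)^x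
    and multiplying by the beta exponential density turns the mixture integral
    into a finite signed combination of integrals of
      c e^-(p c l) (1 - e^-(c l))^(a - 1),   p = b + (j + m + beta x - x) / c,
    and each of these equals B(p, a) = Gamma(p) Gamma(a) / Gamma(p + a)
    ([integral_be_kernel]).  Every p is positive because beta >= 1, so that
    all the integrals converge and may be summed termwise.

    The analytic content is thus Euler's identity for the beta function with
    arbitrary positive real parameters ([Beta_integral]).  It is obtained by
    rescaling the variable of Gamma(a) by that of Gamma(p), exchanging the two
    integrations by Tonelli's theorem, and recognizing Gamma(p + a) in the
    inner integral; this leaves the integral of
    v^(a - 1) (1 + v)^-(p + a) over v > 0, and v = e^(c l) - 1 brings it to the
    form above.  Division by Gamma(p + a) uses that Gamma is finite and
    positive at positive arguments.  The integrands may be singular at 0, so all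
    changes of variables go through a substitution rule on the open half-line
    ([ge0_integration_by_substitution_0y]).

    For random variables L and X the probability of X = x is the mixture
    integral because L is almost surely positive, because integration over the
    sample space against L is integration against the law of L, and because
    this law has the beta exponential density ([gnb_be_mixture]). *)

(** * Substitution on the half-line and Tonelli on rectangles *)

(** Substitution y = F x for nonnegative integrands that may blow up at either
    end: on each [1/(n+1), n+1] the rule for compact intervals applies, and
    these intervals and their images increase to the half-line and to i, so
    that monotone convergence concludes. *)
Lemma ge0_integration_by_substitution_0y {R : realType} (i : interval R)
    (F f G : R -> R) :
  (forall x : R, 0 < x -> is_derive x 1 F (f x)) ->
  {in `]0%R, +oo[, continuous f} -> (forall x : R, 0 < x -> 0 < f x) ->
  (forall x : R, 0 < x -> F x \in i) ->
  (forall y, y \in i -> exists2 x : R, 0 < x & F x = y) ->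
  measurable_fun [set` i] G -> {in i, continuous G} ->
  {in i, forall y : R, 0 <= G y} ->
  (\int[@lebesgue_measure R]_(y in [set` i]) (G y)%:E =
   \int[@lebesgue_measure R]_(x in `]0%R, +oo[) (G (F x) * f x)%:E)%E.
Proof.
move=> dF cf f0 Fi iF mG cG G0.
have cF (x : R) : 0 < x -> {for x, continuous F}.
  move=> x0; apply: differentiable_continuous; apply/derivable1_diffP.
  by have [] := dF _ x0.
have F'E (x : R) : 0 < x -> F^`()%classic x = f x.
  by move=> x0; rewrite derive1E; have [_ ->] := dF _ x0.
have F'near (x : R) : 0 < x -> \near x, f x = F^`()%classic x.
  by move=> x0; near=> y; rewrite F'E//; near: y; exact: lt_nbhsr.
have cF' (x : R) : 0 < x -> {for x, continuous F^`()%classic}.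
  move=> x0; rewrite /prop_for /continuous_at F'E//.
  apply: cvg_trans (cf x _); last by rewrite in_itv/= x0.
  by apply: near_eq_cvg; exact: F'near.
have Finc (x y : R) : 0 < x -> x < y -> F x < F y.
  move=> x0 xy; rewrite -subr_gt0.
  have [z zxy ->] : exists2 z, z \in `]x, y[ & F y - F x = f z * (y - x).
    apply: MVT => // [z|].
      by rewrite in_itv/= => /andP[xz _]; apply: dF; exact: lt_trans xz.
    apply: continuous_in_subspaceT => z; rewrite inE/= in_itv/= => /andP[xz _].
    by apply: cF; exact: lt_le_trans xz.
  move: zxy; rewrite in_itv/= => /andP[xz _].
  by rewrite mulr_gt0 ?subr_gt0// f0// (lt_trans x0).
have Fle (x y : R) : 0 < x -> x <= y -> F x <= F y.
  by move=> x0; rewrite le_eqVlt => /predU1P[->//|/Finc/ltW]; exact.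
pose l (n : nat) : R := n.+1%:R^-1; pose u (n : nat) : R := n.+1%:R.
have l0 n : 0 < l n by rewrite invr_gt0.
have lu n : l n <= u n.
  by rewrite (@le_trans _ _ 1)// ?invf_le1 ?ler1n.
have u0 n : 0 < u n by exact: ltr0Sn.
have l_mono m n : (m <= n)%N -> l n <= l m.
  by move=> mn; rewrite lef_pV2 ?posrE// ler_nat.
have u_mono m n : (m <= n)%N -> u m <= u n by move=> mn; rewrite ler_nat.
have xlu (x : R) : 0 < x -> exists n, l n <= x <= u n.
  move=> x0; have [k xk] : exists k, k%:R > x + x^-1.
    exists (Num.bound (x + x^-1)).
    by apply: archi_boundP; rewrite addr_ge0// ?invr_ge0 ltW.
  have kSk : k%:R <= k.+1%:R :> R by rewrite ler_nat.
  have xV0 : 0 < x^-1 by rewrite invr_gt0.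
  exists k; apply/andP; split; last first.
    by rewrite /u (le_trans _ kSk)// (le_trans _ (ltW xk))// lerDl ltW.
  rewrite /l -[leRHS]invrK lef_pV2 ?posrE//.
  by rewrite (le_trans _ kSk)// (le_trans _ (ltW xk))// lerDr ltW.
have -> : [set` i] = \bigcup_n `[F (l n), F (u n)]%classic.
  apply/seteqP; split=> [y /= /iF[x x0 <-]|y [n _]].
    have [n /andP[lx xu]] := xlu _ x0.
    by exists n => //=; rewrite in_itv/= !Fle.
  rewrite /= in_itv/= => /andP[ly yu].
  have := @interval_is_interval _ i (F (l n)) (F (u n)).
  by move=> /(_ (Fi _ (l0 n)) (Fi _ (u0 n))) /= H; apply: H; rewrite ly yu.
have -> : `]0%R, +oo[%classic = \bigcup_n `[l n, u n]%classic.
  apply/seteqP; split=> [x|x [n _]]; rewrite /= in_itv/= ?andbT.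
    by move=> /xlu[n lxu]; exists n => //=; rewrite in_itv.
  by move=> /andP[lx _]; rewrite in_itv/= andbT (lt_le_trans _ lx).
have subi n : `[F (l n), F (u n)]%classic `<=` [set` i].
  move=> y; rewrite /= in_itv/= => /andP[ly yu].
  have := @interval_is_interval _ i (F (l n)) (F (u n)).
  by move=> /(_ (Fi _ (l0 n)) (Fi _ (u0 n))) /= H; apply: H; rewrite ly yu.
have sub0 n : `[l n, u n]%classic `<=` `]0%R, +oo[%classic.
  move=> x; rewrite /= !in_itv/= andbT => /andP[lx _].
  exact: lt_le_trans lx.
have E n : (\int[@lebesgue_measure R]_(y in `[F (l n), F (u n)]) (G y)%:E =
    \int[@lebesgue_measure R]_(x in `[l n, u n]) (G (F x) * f x)%:E)%E.
  rewrite integration_by_substitution_increasing//.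
  - apply: eq_integral => x; rewrite inE/= in_itv/= => /andP[lx _].
    by rewrite -F'E// (lt_le_trans _ lx).
  - move=> x y; rewrite in_itv/= => /andP[lx _] _.
    by apply: Finc; exact: lt_le_trans lx.
  - move=> x; rewrite in_itv/= => /andP[lx _].
    by apply: cF'; exact: lt_trans lx.
  - by apply: cvgP; apply: cvg_at_right_filter; exact: cF'.
  - by apply: cvgP; apply: cvg_at_left_filter; exact: cF'.
  - split.
    + move=> x; rewrite in_itv/= => /andP[lx _].
      by have [] := dF x (lt_trans (l0 n) lx).
    + by apply: cvg_at_right_filter; exact: cF.
    + by apply: cvg_at_left_filter; exact: cF.
  - apply: continuous_in_subspaceT => y; rewrite inE => /subi; exact: cG.
have mf : measurable_fun (`]0%R, +oo[ : set R) (fun x => G (F x) * f x).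
  apply: open_continuous_measurable_fun => // x.
  rewrite inE/= in_itv/= andbT => x0.
  apply: (@continuousM _ R^o (G \o F) f).
    by apply: continuous_comp; [exact: cF|exact/cG/Fi].
  by apply: cf; rewrite in_itv/= x0.
have cvgL : (\int[@lebesgue_measure R]_(y in `[F (l n), F (u n)]) (G y)%:E
    @[n --> \oo] --> \int[@lebesgue_measure R]_(y in
      \bigcup_n `[F (l n), F (u n)]%classic) (G y)%:E)%E.
  apply: ge0_nondecreasing_set_cvg_integral.
  - move=> m n mn; rewrite subsetEset => y; rewrite /= !in_itv/=.
    move=> /andP[ly yu].
    by rewrite (le_trans _ ly) ?Fle ?l_mono// (le_trans yu)// Fle ?u_mono.
  - by move=> n; exact: measurable_itv.
  - by move=> n; apply/measurable_EFinP; apply: measurable_funS mG.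
  - by move=> n y /subi iy; rewrite lee_fin; exact: G0.
rewrite (funext E) in cvgL.
apply: (cvg_unique (@ereal_hausdorff R) cvgL).
apply: ge0_nondecreasing_set_cvg_integral.
- move=> m n mn; rewrite subsetEset => x; rewrite /= !in_itv/= => /andP[lx xu].
  by rewrite (le_trans _ lx) ?l_mono// (le_trans xu)// u_mono.
- by move=> n; exact: measurable_itv.
- by move=> n; apply/measurable_EFinP; apply: measurable_funS mf.
- move=> n x /sub0/=; rewrite in_itv/= andbT => x0.
  by rewrite lee_fin mulr_ge0 ?G0 ?Fi// ltW// f0.
Unshelve. all: by end_near. Qed.

(** Tonelli's theorem for the extension of f by 0 outside the rectangle. *)
Lemma fubini_tonelli_in d1 d2 (T1 : measurableType d1) (T2 : measurableType d2)
    {R : realType} (m1 : {sigma_finite_measure set T1 -> \bar R})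
    (m2 : {sigma_finite_measure set T2 -> \bar R}) (A : set T1) (B : set T2)
    (f : T1 * T2 -> \bar R) :
  measurable A -> measurable B -> measurable_fun (A `*` B) f ->
  (forall z, (A `*` B) z -> 0 <= f z)%E ->
  (\int[m1]_(x in A) \int[m2]_(y in B) f (x, y) =
   \int[m2]_(y in B) \int[m1]_(x in A) f (x, y))%E.
Proof.
move=> mA mB mf f0.
have := @fubini_tonelli _ _ _ _ _ m1 m2 (f \_ (A `*` B)).
have -> : (\int[m1]_x \int[m2]_y (f \_ (A `*` B)) (x, y) =
    \int[m1]_(x in A) \int[m2]_(y in B) f (x, y))%E.
  rewrite [RHS]integral_mkcond; apply: eq_integral => x _; rewrite patchE.
  case: ifPn => [xA|xA].
    rewrite [RHS]integral_mkcond; apply: eq_integral => y _.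
    by rewrite !patchE in_setX xA.
  by apply: integral0_eq => y _; rewrite patchE in_setX (negbTE xA).
have -> : (\int[m2]_y \int[m1]_x (f \_ (A `*` B)) (x, y) =
    \int[m2]_(y in B) \int[m1]_(x in A) f (x, y))%E.
  rewrite [RHS]integral_mkcond; apply: eq_integral => y _; rewrite patchE.
  case: ifPn => [yB|yB].
    rewrite [RHS]integral_mkcond; apply: eq_integral => x _.
    by rewrite !patchE in_setX yB andbT.
  by apply: integral0_eq => x _; rewrite patchE in_setX (negbTE yB) andbF.
apply.
- by apply/(measurable_restrictT _ _).1 => //; exact: measurableX.
- by move=> z; apply: erestrict_ge0 => {}z; exact: f0.
Qed.

(** * The Gamma and Beta functions at positive real arguments *)

Lemma powR_lt1 {R : realType} (x s : R) : 0 < s -> 0 <= x -> x < 1 ->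
  x `^ s < 1.
Proof.
move=> s0 x0 x1; rewrite [ltRHS](_ : 1 = 1 `^ s); last by rewrite powR1.
by rewrite gt0_ltr_powR// nnegrE.
Qed.

Lemma continuous_powR_gt0 {R : realType} (s x : R) : 0 < x ->
  {for x, continuous (fun t : R => t `^ s)}.
Proof.
move=> x0; apply: differentiable_continuous; apply/derivable1_diffP.
by apply: derivable_powR; rewrite in_itv/= x0.
Qed.

Lemma continuous_Gamma_integrand {R : realType} (r x : R) : 0 < x ->
  {for x, continuous (fun t : R => t `^ (r - 1) * expR (- t))}.
Proof.
move=> x0; apply: (@continuousM R R (fun t : R => t `^ (r - 1))
  (fun t : R => expR (- t))).
  exact: continuous_powR_gt0.
apply: (@continuous_comp _ _ _ (fun t : R => - t) expR).
  by apply: (@continuousN R R) => ?; exact: cvg_id.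
exact: continuous_expR.
Qed.

Lemma measurable_Gamma_rate_integrand {R : realType} (r k : R) (D : set R) :
  measurable_fun D (fun t : R => (t `^ (r - 1) * expR (- (k * t)))%:E).
Proof.
apply/measurable_EFinP; apply: measurable_funTS; apply: measurable_funM.
  exact: measurable_powR.
apply: measurableT_comp => //; exact: measurableT_comp.
Qed.

Lemma measurable_Gamma_integrand {R : realType} (r : R) (D : set R) :
  measurable_fun D (fun t : R => (t `^ (r - 1) * expR (- t))%:E).
Proof.
apply: eq_measurable_fun (measurable_Gamma_rate_integrand r 1 _) => t _.
by rewrite mul1r.
Qed.

(** The right-hand side is a multiple of the derivative of (t / (1 + t))^r,
    which increases from 0 to 1: this bounds the integrand near 0 and at
    infinity at once. The constant comes from 1 + t <= s (1 + t / s) <=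
    s e^(t / s) for s = r + 1, raised to the power s. *)
Lemma Gamma_integrand_le {R : realType} (r t : R) : 0 < r -> 0 < t ->
  t `^ (r - 1) * expR (- t) <=
  (r + 1) `^ (r + 1) / r *
    (r * (t / (1 + t)) `^ (r - 1) * (1 + t) ^- 2).
Proof.
move=> r0 t0; set s := r + 1.
have s0 : 0 < s by rewrite addr_gt0.
have t1 : 0 < 1 + t by rewrite addr_gt0.
have H : (1 + t) `^ s <= s `^ s * expR t.
  have : 1 + t <= s * expR (t / s).
    rewrite (@le_trans _ _ (s * (1 + t / s)))//; last first.
      by rewrite ler_pM2l// expR_ge1Dx.
    rewrite mulrDr mulr1 mulrCA divff ?gt_eqF// mulr1 lerD2r.
    by rewrite /s lerDr ltW.
  move=> /(ge0_ler_powR (ltW s0)); rewrite !nnegrE (ltW t1) => /(_ isT).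
  rewrite mulr_ge0 ?expR_ge0 ?(ltW s0)// => /(_ isT) /le_trans; apply.
  rewrite powRM ?expR_ge0 ?(ltW s0)//.
  by rewrite -expRM mulrAC -mulrA divff ?gt_eqF ?mulr1.
rewrite -(mulrA r); have -> : (t / (1 + t)) `^ (r - 1) * (1 + t) ^- 2 =
    t `^ (r - 1) * ((1 + t) `^ s)^-1.
  rewrite powRM ?invr_ge0 ?ltW// -mulrA; congr (_ * _).
  rewrite -(powR_inv1 (ltW t1)) -powRrM mulN1r -powR_invn ?ltW//.
  rewrite -powRD; last by rewrite (gt_eqF t1) implybT.
  rewrite -powRN; congr (_ `^ _); rewrite /s opprB opprD addrAC.
  by ring.
rewrite -!mulrA mulKf ?gt_eqF// mulrCA ler_pM2l ?powR_gt0//.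
by rewrite expRN ler_pdivlMr ?powR_gt0// mulrC ler_pdivrMr ?expR_gt0.
Qed.

Lemma Gamma_integral_lty {R : realType} (r : R) : 0 < r ->
  (\int[@lebesgue_measure R]_(t in `]0%R, +oo[)
    (t `^ (r - 1) * expR (- t))%:E < +oo)%E.
Proof.
move=> r0; pose F (t : R) := (t / (1 + t)) `^ r.
pose f (t : R) : R := r * (t / (1 + t)) `^ (r - 1) * (1 + t) ^- 2.
have t1 (t : R) : 0 < t -> 0 < 1 + t by move=> t0; rewrite addr_gt0.
have tt1 (t : R) : 0 < t -> 0 < t / (1 + t).
  by move=> t0; rewrite divr_gt0// t1.
have f0 (t : R) : 0 < t -> 0 < f t.
  move=> t0; rewrite /f mulr_gt0//; last by rewrite invr_gt0 exprn_gt0 ?t1.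
  by rewrite mulr_gt0// powR_gt0// tt1.
have drat (t : R) : 0 < t ->
    is_derive t 1 (fun t : R => t / (1 + t)) ((1 + t) ^- 2).
  move=> t0; have n0 : 1 + t != 0 by rewrite gt_eqF// t1.
  have d1 : is_derive t 1 (fun t : R => 1 + t) 1.
    by apply: is_derive_eq; rewrite add0r mulr1.
  have dM := is_deriveM (is_derive_id t 1) (is_deriveV n0 d1).
  apply: is_derive_eq.
  by rewrite /GRing.scale/=; field.
have crat (t : R) : 0 < t -> {for t, continuous (fun t : R => t / (1 + t))}.
  move=> t0; apply: differentiable_continuous; apply/derivable1_diffP.
  by have [] := drat _ t0.
have cf (x : R) : 0 < x -> {for x, continuous f}.
  move=> x0.
  apply: (@continuousM R R (fun t : R => r * (t / (1 + t)) `^ (r - 1))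
     (fun t : R => (1 + t) ^- 2)).
    apply: (@continuousM R R (cst r) (fun t : R => (t / (1 + t)) `^ (r - 1))).
      exact: cst_continuous.
    apply: (@continuous_comp _ _ _ (fun t : R => t / (1 + t))
      (fun t => t `^ (r - 1))); first exact: crat.
    by apply: continuous_powR_gt0; exact: tt1.
  apply: (@continuousV R R (fun t : R => (1 + t) ^+ 2)).
    by rewrite expf_eq0/= gt_eqF ?t1.
  apply: (@continuous_comp _ _ _ (fun t : R => 1 + t) (fun t => t ^+ 2)).
    by apply: (@continuousD R R R (cst 1) id); [exact: cst_continuous|].
  exact: exprn_continuous.
have dF (t : R) : 0 < t -> is_derive t 1 F (f t).
  move=> t0; apply: (@is_derive1_comp R (fun t => t `^ r)).
    by apply: is_derive1_powR; exact: tt1.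
  exact: drat.
(* Substituting y = F t in the integral of 1 over ]0, 1[. *)
have intf : (\int[@lebesgue_measure R]_(t in `]0%R, +oo[) (f t)%:E = 1)%E.
  transitivity (\int[@lebesgue_measure R]_(t in `]0%R, +oo[)
      (cst 1 (F t) * f t)%:E)%E.
    by apply: eq_integral => t _; rewrite mul1r.
  rewrite -(@ge0_integration_by_substitution_0y R `]0%R, 1%R[ F f (cst 1) dF)//.
  - rewrite (eq_integral (cst 1%E))// integral_cst//= mul1e.
    by rewrite lebesgue_measure_itv/= lte_fin ltr01 oppr0 adde0.
  - by move=> x; rewrite in_itv/= andbT => x0; exact: cf.
  - move=> x x0; rewrite /F in_itv/= powR_gt0 ?tt1//=.
    rewrite powR_lt1 ?(ltW (tt1 _ x0))//.
    by rewrite ltr_pdivrMr ?t1// mul1r ltrDr.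
  - move=> y; rewrite in_itv/= => /andP[y0 y1].
    pose z := y `^ r^-1; have z0 : 0 < z by exact: powR_gt0.
    have z1 : z < 1 by rewrite powR_lt1 ?invr_gt0// ltW.
    have z1' : 1 - z != 0 by rewrite subr_eq0 gt_eqF.
    exists (z / (1 - z)); first by rewrite divr_gt0// subr_gt0.
    rewrite /F (_ : _ / _ = z); last first.
      by field; rewrite z1' subrK oner_neq0.
    by rewrite /z -powRrM mulVf ?gt_eqF// powRr1// ltW.
  - by move=> y _; exact: cst_continuous.
have mf : measurable_fun (`]0%R, +oo[ : set R) f.
  apply: open_continuous_measurable_fun => // x.
  by rewrite inE/= in_itv/= andbT => x0; exact: cf.
apply: (@le_lt_trans _ _ (\int[@lebesgue_measure R]_(t in `]0%R, +oo[)
   (((r + 1) `^ (r + 1) / r)%:E * (f t)%:E))%E).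
  apply: ge0_le_integral => //.
  - by move=> t _; rewrite lee_fin mulr_ge0 ?powR_ge0 ?expR_ge0.
  - exact: measurable_Gamma_integrand.
  - by apply/measurable_EFinP; apply: measurable_funM.
  - move=> t; rewrite /= in_itv/= andbT => t0.
    by rewrite lee_fin Gamma_integrand_le.
rewrite ge0_integralZl ?intf ?mule1 ?ltry//.
- by apply/measurable_EFinP.
- by move=> t; rewrite /= in_itv/= andbT => /f0/ltW; rewrite lee_fin.
- by rewrite lee_fin divr_ge0 ?powR_ge0// ltW.
Qed.

(** Finiteness is what makes the real-valued integral defining Gamma agree with
    the extended one, to which the nonnegative theory applies. *)
Lemma EFin_Gamma {R : realType} (r : R) : 0 < r ->
  ((Gamma r)%:E = \int[@lebesgue_measure R]_(t in `]0%R, +oo[)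
    (t `^ (r - 1) * expR (- t))%:E)%E.
Proof.
move=> r0; rewrite /Gamma /Rintegral fineK// ge0_fin_numE ?Gamma_integral_lty//.
by apply: integral_ge0 => t _; rewrite lee_fin mulr_ge0 ?powR_ge0 ?expR_ge0.
Qed.

Lemma Gamma_gt0 {R : realType} (r : R) : 0 < r -> 0 < Gamma r.
Proof.
move=> r0; rewrite -lte_fin EFin_Gamma// lt0e.
rewrite integral_ge0 ?andbT => [|t _]; last first.
  by rewrite lee_fin mulr_ge0 ?powR_ge0 ?expR_ge0.
(* A null integral would make the positive integrand vanish almost everywhere
   on a half-line of infinite measure. *)
apply/eqP => int0.
have mf : measurable_fun (`]0%R, +oo[ : set R)
    (fun t : R => (t `^ (r - 1) * expR (- t))%:E).
  exact: measurable_Gamma_integrand.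
have [+ _] := ae_eq_integral_abs (@lebesgue_measure R)
  (measurable_itv `]0%R, +oo[) mf.
under eq_integral do rewrite gee0_abs ?lee_fin ?mulr_ge0 ?powR_ge0 ?expR_ge0//.
move=> /(_ int0)[N [mN N0 subN]].
suff : (@lebesgue_measure R `]0%R, +oo[ <= @lebesgue_measure R N)%E.
  by rewrite N0 lebesgue_measure_itv/= ltry.
apply: le_measure; rewrite ?inE// => t /= t0; apply: subN => /= /(_ t0) [].
move: t0; rewrite in_itv/= andbT => t0.
by apply/eqP; rewrite gt_eqF// mulr_gt0 ?powR_gt0 ?expR_gt0.
Qed.

(** Substitution t |-> k t in Gamma r. *)
Lemma Gamma_rate {R : realType} (r k : R) : 0 < r -> 0 < k ->
  (\int[@lebesgue_measure R]_(t in `]0%R, +oo[)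
    (t `^ (r - 1) * expR (- (k * t)))%:E = (Gamma r / k `^ r)%:E)%E.
Proof.
move=> r0 k0; rewrite EFinM EFin_Gamma//.
have dF (t : R) : 0 < t -> is_derive t 1 ( *%R k) k.
  by move=> _; apply: is_derive_eq; rewrite /GRing.scale/= mulr1.
rewrite (@ge0_integration_by_substitution_0y R `]0%R, +oo[ _ (cst k)
  (fun t => t `^ (r - 1) * expR (- t)) dF)//; last first.
- by move=> t _; rewrite mulr_ge0 ?powR_ge0 ?expR_ge0.
- move=> t; rewrite in_itv/= andbT => t0.
  exact: continuous_Gamma_integrand.
- by apply/measurable_EFinP; exact: measurable_Gamma_integrand.
- move=> t; rewrite in_itv/= andbT => t0.
  exists (t / k); first by rewrite divr_gt0.
  by rewrite mulrC divfK ?gt_eqF.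
- by move=> t t0; rewrite in_itv/= andbT mulr_gt0.
- by move=> t _; exact: cst_continuous.
transitivity (((k `^ r)%:E * \int[@lebesgue_measure R]_(t in `]0%R, +oo[)
    (t `^ (r - 1) * expR (- (k * t)))%:E) * ((k `^ r)^-1)%:E)%E.
  by rewrite muleAC -EFinM divff ?mul1e// gt_eqF// powR_gt0.
rewrite -ge0_integralZl//.
- congr (_ * _)%E; apply: eq_integral => t; rewrite inE/= in_itv/= andbT => t0.
  rewrite -EFinM powRM ?ltW//; congr EFin.
  rewrite -[in LHS](mulr_powRB1 (ltW k0) r0); ring.
- exact: measurable_Gamma_rate_integrand.
- by move=> t _; rewrite lee_fin mulr_ge0 ?powR_ge0 ?expR_ge0.
- by rewrite lee_fin powR_ge0.
Qed.

(** The beta integral on the half-line: Gamma p * Gamma a is a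
    double integral which, once the variable of Gamma a is written s v, can be
    integrated first in s, giving Gamma (p + a) * (1 + v)^-(p + a). *)
Lemma Beta_integral {R : realType} (p a : R) : 0 < p -> 0 < a ->
  ((Beta p a)%:E = \int[@lebesgue_measure R]_(v in `]0%R, +oo[)
    (v `^ (a - 1) * (1 + v) `^ (- (p + a)))%:E)%E.
Proof.
move=> p0 a0; have pa0 : 0 < p + a by rewrite addr_gt0.
set I := (RHS).
suff GI : ((Gamma p * Gamma a)%:E = I * (Gamma (p + a))%:E)%E.
  rewrite /Beta EFinM GI -muleA -EFinM divff ?mule1// gt_eqF//.
  exact: Gamma_gt0.
pose h (s v : R) := s `^ (p + a - 1) * expR (- ((1 + v) * s)) * v `^ (a - 1).
have h0 s v : (0 <= (h s v)%:E)%E.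
  by rewrite lee_fin !mulr_ge0 ?powR_ge0 ?expR_ge0.
have mh : measurable_fun [set: R * R] (fun z => (h z.1 z.2)%:E).
  apply/measurable_EFinP; apply: measurable_funM; first apply: measurable_funM.
  - by apply: (measurableT_comp (measurable_powR _)); exact: measurable_fst.
  - apply: measurableT_comp => //; apply: measurableT_comp => //.
    apply: measurable_funM; last exact: measurable_fst.
    by apply: measurable_funD => //; exact: measurable_snd.
  - by apply: (measurableT_comp (measurable_powR _)); exact: measurable_snd.
transitivity (\int[@lebesgue_measure R]_(s in `]0%R, +oo[)
    \int[@lebesgue_measure R]_(v in `]0%R, +oo[) (h s v)%:E)%E.
  rewrite mulrC EFinM (EFin_Gamma _ p0) -ge0_integralZl//.
  - apply: eq_integral => s; rewrite inE/= in_itv/= andbT => s0.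
    transitivity (((s `^ (p + a - 1) * expR (- s))%:E *
        \int[@lebesgue_measure R]_(v in `]0%R, +oo[)
          (v `^ (a - 1) * expR (- (s * v)))%:E)%E).
      rewrite Gamma_rate// -!EFinM; congr EFin.
      rewrite addrAC (@powRD _ s (p - 1) a).
        by field; rewrite gt_eqF// powR_gt0.
      by rewrite (gt_eqF s0) implybT.
    rewrite -ge0_integralZl//.
    + apply: eq_integral => v _; rewrite -EFinM /h; congr EFin.
      rewrite mulrDl mul1r opprD expRD (mulrC v); ring.
    + exact: measurable_Gamma_rate_integrand.
    + by move=> t _; rewrite lee_fin mulr_ge0 ?powR_ge0 ?expR_ge0.
    + by rewrite lee_fin mulr_ge0 ?powR_ge0 ?expR_ge0.
  - exact: measurable_Gamma_integrand.
  - by move=> t _; rewrite lee_fin mulr_ge0 ?powR_ge0 ?expR_ge0.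
  - by rewrite lee_fin ltW// Gamma_gt0.
rewrite (@fubini_tonelli_in _ _ _ _ R lebesgue_measure lebesgue_measure
  `]0%R, +oo[ `]0%R, +oo[ (fun z => (h z.1 z.2)%:E))//; last first.
  exact: measurable_funTS.
rewrite muleC -ge0_integralZl//; last 3 first.
- apply/measurable_EFinP; apply: measurable_funM.
    by apply: measurable_funTS; exact: measurable_powR.
  apply: measurable_funTS; apply: (measurableT_comp (measurable_powR _)).
  exact: measurable_funD.
- by move=> t _; rewrite lee_fin mulr_ge0 ?powR_ge0.
- by rewrite lee_fin ltW// Gamma_gt0.
apply: eq_integral => v; rewrite inE/= in_itv/= andbT => v0.
have v1 : 0 < 1 + v by rewrite addr_gt0.
rewrite /h; under eq_integral do rewrite EFinM.
rewrite ge0_integralZr//.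
- by rewrite Gamma_rate// -!EFinM; congr EFin; rewrite powRN; ring.
- exact: measurable_Gamma_rate_integrand.
- by move=> t _; rewrite lee_fin mulr_ge0 ?powR_ge0 ?expR_ge0.
- by rewrite lee_fin powR_ge0.
Qed.

(** * Beta exponential integrals *)

(** The unnormalized density of BE(a, p, c): its exponent p varies with the
    index of the binomial expansion while a and c stay fixed. *)
Definition be_kernel {R : realType} (p a c x : R) : R :=
  c * expR (- (p * c * x)) * (1 - expR (- (c * x))) `^ (a - 1).

Lemma be_kernel_ge0 {R : realType} (p a c x : R) : 0 < c ->
  0 <= be_kernel p a c x.
Proof. by move=> c0; rewrite !mulr_ge0 ?expR_ge0 ?powR_ge0// ltW. Qed.

Lemma measurable_be_kernel {R : realType} (p a c : R) (D : set R) :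
  measurable_fun D (be_kernel p a c).
Proof.
apply: measurable_funTS; apply: measurable_funM.
  apply: measurable_funM => //.
  by apply: measurableT_comp => //; exact: measurableT_comp.
apply: (measurableT_comp (measurable_powR _)); apply: measurable_funB => //.
by apply: measurableT_comp => //; exact: measurableT_comp.
Qed.

(** The substitution v = e^(c x) - 1 in [Beta_integral]: then 1 + v = e^(c x)
    and v = e^(c x) (1 - e^-(c x)). *)
Lemma integral_be_kernel {R : realType} (p a c : R) :
  0 < p -> 0 < a -> 0 < c ->
  (\int[@lebesgue_measure R]_(x in `]0%R, +oo[) (be_kernel p a c x)%:E =
   (Beta p a)%:E)%E.
Proof.
move=> p0 a0 c0; rewrite [RHS](Beta_integral _ _ p0 a0).
pose F (x : R) := expR (c * x) - 1; pose f (x : R) := c * expR (c * x).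
have dF (x : R) : 0 < x -> is_derive x 1 F (f x).
  move=> _; have dc : is_derive x 1 ( *%R c) c.
    by apply: is_derive_eq; rewrite /GRing.scale/= mulr1.
  have dE := is_derive1_comp (is_derive_expR (c * x)) dc.
  by apply: is_derive_eq; rewrite subr0 mulrC.
rewrite (@ge0_integration_by_substitution_0y R `]0%R, +oo[ F f
  (fun v => v `^ (a - 1) * (1 + v) `^ (- (p + a))) dF)//.
- apply: eq_integral => x; rewrite inE/= in_itv/= andbT => x0; congr EFin.
  have E0 : 0 < 1 - expR (- (c * x)).
    by rewrite subr_gt0 expR_lt1 oppr_lt0 mulr_gt0.
  have FE : F x = expR (c * x) * (1 - expR (- (c * x))).
    by rewrite mulrBr mulr1 -expRD subrr expR0.
  rewrite {2}/F [1 + _]addrC subrK FE powRM ?expR_ge0 ?(ltW E0)//.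
  rewrite -!expRM /be_kernel /f.
  have -> : expR (- (p * c * x)) = expR (c * x * (a - 1)) *
      expR (c * x * - (p + a)) * expR (c * x).
    by rewrite -!expRD; congr expR; ring.
  move: (expR (c * x)) (expR (_ * (a - 1))) (expR (_ * - _)) (_ `^ _).
  by move=> u v w z; ring.
- move=> x _; apply: (@continuousM R R (cst c) (fun x => expR (c * x))).
    exact: cst_continuous.
  apply: (@continuous_comp _ _ _ ( *%R c) expR); last exact: continuous_expR.
  exact: mulrl_continuous.
- by move=> x x0; rewrite mulr_gt0 ?expR_gt0.
- by move=> x x0; rewrite in_itv/= andbT subr_gt0 expR_gt1 mulr_gt0.
- move=> v; rewrite in_itv/= andbT => v0; exists (ln (1 + v) / c).
    by rewrite divr_gt0// ln_gt0// ltrDl.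
  rewrite /F mulrC divfK ?gt_eqF// lnK ?posrE ?addr_gt0//.
  by rewrite addrC addKr.
- apply: measurable_funTS; apply: measurable_funM; first exact: measurable_powR.
  apply: (measurableT_comp (measurable_powR _)); exact: measurable_funD.
- move=> v; rewrite in_itv/= andbT => v0.
  apply: (@continuousM R R (fun v => v `^ (a - 1))
    (fun v => (1 + v) `^ (- (p + a)))); first exact: continuous_powR_gt0.
  apply: (@continuous_comp _ _ _ (fun v : R => 1 + v)
    (fun v => v `^ (- (p + a)))).
    by apply: (@continuousD R R R (cst 1) id); [exact: cst_continuous|].
  by apply: continuous_powR_gt0; rewrite addr_gt0.
- by move=> v _; rewrite mulr_ge0 ?powR_ge0.
Qed.

(** The coefficients of the binomial expansion alternate in sign, so additivity
    for nonnegative functions does not apply. *)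
Lemma integral_lincomb d (T : measurableType d) {R : realType}
    (mu : {measure set T -> \bar R}) (D : set T) (I : Type) (s : seq I)
    (k v : I -> R) (g : I -> T -> R) :
  measurable D -> (forall i, mu.-integrable D (EFin \o g i)) ->
  (forall i, \int[mu]_(x in D) (g i x)%:E = (v i)%:E)%E ->
  (\int[mu]_(x in D) (\sum_(i <- s) k i * g i x)%:E =
   (\sum_(i <- s) k i * v i)%:E)%E.
Proof.
move=> mD ig gv.
have iks i : mu.-integrable D (fun x => ((k i)%:E * (g i x)%:E)%E).
  have := integrableZl mD (k i) (ig i); exact.
elim: s => [|i s IHs].
  rewrite big_nil -[RHS](integral0 mu D).
  by apply: eq_integral => x _; rewrite big_nil.
under eq_integral do rewrite big_cons EFinD EFinM.
rewrite integralD//.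
  by rewrite (integralZl mD (ig i))/= gv IHs -EFinM -EFinD big_cons.
rewrite [X in _.-integrable _ X](_ : _ =
    (fun x => \sum_(j <- s) (k j)%:E * (g j x)%:E)%E).
  by apply: integrable_sum => // j _; exact: iks.
by apply/funext => x; rewrite -sumEFin.
Qed.

(** * The mixture integral *)

(** All factors m + beta x - i of the binomial coefficient are nonnegative
    since i < x <= beta x. *)
Lemma gnb_pmf_ge0 {R : realType} (m beta t : R) (x : nat) :
  0 < m -> 1 <= beta -> t <= 1 -> 0 <= gnb_pmf m beta t x.
Proof.
move=> m0 b1 t1; have b0 : 0 <= beta by rewrite (le_trans _ b1).
rewrite /gnb_pmf mulr_ge0 ?powR_ge0// mulr_ge0 ?exprn_ge0 ?subr_ge0//.
rewrite mulr_ge0//.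
  by rewrite divr_ge0 ?addr_ge0 ?mulr_ge0// ltW.
rewrite /gbinom divr_ge0//; apply: prodr_ge0 => i _.
rewrite subr_ge0 (@le_trans _ _ x%:R)//; first by rewrite ler_nat ltnW.
by rewrite (@le_trans _ _ (beta * x%:R)) ?ler_peMl// lerDr ltW.
Qed.

(** Binomial expansion of (1 - e^-l)^x; the factor e^-(j l) and the power of
    e^-l are absorbed in the exponent of the density. *)
Lemma gnb_pmf_be_pdf {R : realType} (m beta a b c l : R) (x : nat) :
  0 < c -> 0 < l ->
  gnb_pmf m beta (expR (- l)) x * be_pdf a b c l =
  \sum_(0 <= j < x.+1)
    m / (m + beta * x%:R) * gbinom (m + beta * x%:R) x *
    ('C(x, j)%:R * (-1) ^+ j / Beta a b) *
    be_kernel (b + (j%:R + m + beta * x%:R - x%:R) / c) a c l.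
Proof.
move=> c0 l0; rewrite /gnb_pmf /be_pdf l0.
set K := m / _ * _; rewrite exprBn -(big_mkord xpredT (fun j =>
  (-1) ^+ j * 1 ^+ (x - j) * expR (- l) ^+ j *+ 'C(x, j))).
rewrite mulr_sumr !mulr_suml; apply: eq_bigr => j _.
rewrite expr1n mulr1 -mulr_natl /be_kernel -expRM_natl -expRM.
have -> : expR (- ((b + (j%:R + m + beta * x%:R - x%:R) / c) * c * l)) =
    expR (j%:R * - l) * expR (- l * (m + beta * x%:R - x%:R)) *
    expR (- (b * c * l)).
  by rewrite -!expRD; congr expR; field; rewrite gt_eqF.
move: K (Beta a b) (expR (j%:R * _)) (expR (- l * _))
  (expR (- (b * c * l))) (_ `^ _).
by move=> K B u v w z; ring.
Qed.

Lemma gnb_law_set1 {R : realType} (m beta l : R) (x : nat) :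
  0 < m -> 1 <= beta -> 0 <= l ->
  gnb_law m beta (expR (- l)) [set x] = (gnb_pmf m beta (expR (- l)) x)%:E.
Proof.
move=> m0 b1 l0; rewrite /gnb_law esum_set1// lee_fin gnb_pmf_ge0//.
by rewrite expR_le1 oppr_le0.
Qed.

Lemma gnb_be_law_set1 {R : realType} (m beta a b c : R) (x : nat) :
  0 < m -> 1 <= beta -> 0 < a -> 0 < b -> 0 < c ->
  gnb_be_law m beta a b c [set x] =
  (m / (m + beta * x%:R) * gbinom (m + beta * x%:R) x *
    \sum_(0 <= j < x.+1) 'C(x, j)%:R * (-1) ^+ j *
      (Beta (b + (j%:R + m + beta * x%:R - x%:R) / c) a / Beta a b))%:E.
Proof.
move=> m0 b1 a0 b0 c0; rewrite /gnb_be_law.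
pose q j : R := b + (j%:R + m + beta * x%:R - x%:R) / c.
have q0 j : 0 < q j.
  rewrite addr_gt0// divr_gt0// -addrA ltr_wpDr//; last by rewrite ltr_wpDl.
  by rewrite subr_ge0 ler_peMl.
under eq_integral => l.
  rewrite inE/= in_itv/= andbT => l0.
  rewrite gnb_law_set1 ?(ltW l0)// -EFinM gnb_pmf_be_pdf//.
  over.
rewrite (@integral_lincomb _ _ _ _ _ _ _ _ (fun j => Beta (q j) a))//.
- congr EFin; rewrite mulr_sumr; apply: eq_bigr => j _; rewrite /q; ring.
- move=> j; apply/integrableP; split.
    by apply/measurable_EFinP; exact: measurable_be_kernel.
  under eq_integral do rewrite /= ger0_norm ?be_kernel_ge0//.
  by rewrite (integral_be_kernel _ _ _ (q0 j) a0 c0) ltry.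
- by move=> j; exact: (integral_be_kernel _ _ _ (q0 j) a0 c0).
Qed.

(** * Random variables with the given laws *)

(** By uniqueness of the Radon-Nikodym derivative, g is almost everywhere the
    derivative of nu with respect to mu, so the change of variables for that
    derivative carries over to g. *)
Lemma ge0_integral_density d (T : measurableType d) {R : realType}
    (mu : {sigma_finite_measure set T -> \bar R})
    (nu : {finite_measure set T -> \bar R}) (g : T -> \bar R) (D : set T)
    (f : T -> \bar R) :
  measurable_fun setT g -> (forall x, 0 <= g x)%E ->
  (forall A, measurable A -> nu A = \int[mu]_(x in A) g x)%E ->
  measurable D -> measurable_fun D f -> (forall x, D x -> 0 <= f x)%E ->
  (\int[nu]_(x in D) f x = \int[mu]_(x in D) (f x * g x))%E.
Proof.
move=> mg g0 nuE mD mf f0.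
have numu : nu `<< mu.
  apply/null_content_dominatesP => A mA muA0; rewrite nuE//.
  by apply: null_set_integral => //; exact: measurable_funTS.
have ig : mu.-integrable setT g.
  apply/integrableP; split => //.
  under eq_integral do rewrite gee0_abs//.
  by rewrite -nuE// ltey_eq fin_num_measure.
pose h := Radon_Nikodym_SigmaFinite.f nu mu.
have ih : mu.-integrable setT h.
  exact: Radon_Nikodym_SigmaFinite.f_integrable.
have hg : ae_eq mu setT h g.
  apply: integral_ae_eq => // E _ mE.
  by rewrite -nuE// -Radon_Nikodym_SigmaFinite.f_integral.
have mfD : measurable_fun setT (f \_ D) by exact/(measurable_restrictT _ mD).1.
have f0D x : (0 <= (f \_ D) x)%E by apply: erestrict_ge0.
rewrite integral_mkcond -(Radon_Nikodym_SigmaFinite.change_of_variables numu)//.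
rewrite [RHS]integral_mkcond.
transitivity (\int[mu]_x ((f \_ D) x * g x))%E; last first.
  apply: eq_integral => x _; rewrite !patchE; case: ifPn => // _.
  by rewrite mul0e.
apply: ae_eq_integral => //.
- by apply: emeasurable_funM => //; exact: measurable_int ih.
- exact: emeasurable_funM.
- exact: ae_eqe_mul2l.
Qed.

Lemma measurable_be_pdf {R : realType} (a b c : R) :
  measurable_fun setT (be_pdf a b c).
Proof.
apply: measurable_fun_ifT => //; first exact: measurable_fun_ltr.
apply: measurable_funM; first apply: measurable_funM => //.
  by apply: measurableT_comp => //; exact: measurableT_comp.
apply: (measurableT_comp (measurable_powR _)); apply: measurable_funB => //.
by apply: measurableT_comp => //; exact: measurableT_comp.
Qed.

Lemma Beta_ge0 {R : realType} (a b : R) : 0 < a -> 0 < b -> 0 <= Beta a b.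
Proof.
by move=> a0 b0; rewrite /Beta divr_ge0 ?mulr_ge0// ltW// Gamma_gt0// addr_gt0.
Qed.

Lemma be_pdf_ge0 {R : realType} (a b c x : R) : 0 < a -> 0 < b -> 0 < c ->
  0 <= be_pdf a b c x.
Proof.
move=> a0 b0 c0; rewrite /be_pdf; case: ifPn => // _.
by rewrite !mulr_ge0 ?expR_ge0 ?powR_ge0 ?invr_ge0 ?Beta_ge0// ltW.
Qed.

Lemma measurable_gnb_pmf_expR {R : realType} (m beta : R) (x : nat)
    (D : set R) :
  measurable_fun D (fun l => gnb_pmf m beta (expR (- l)) x).
Proof.
apply: measurable_funTS.
have mexpN : measurable_fun setT (fun l : R => expR (- l)).
  exact: measurableT_comp.
apply: measurable_funM; first apply: measurable_funM => //.
  by apply: measurable_funX; exact: measurable_funB.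
exact: (measurableT_comp (measurable_powR _)).
Qed.

(** Conditioning on the event L > 0, which has probability 1, keeps the
    parameter e^-L of the conditional law in ]0, 1[, where the mass function is
    nonnegative. *)
Lemma gnb_be_mixture d (T : measurableType d) {R : realType}
    (P : probability T R) (L : {RV P >-> R}) (X : {RV P >-> nat})
    (m beta a b c : R) (x : nat) :
  0 < m -> 1 <= beta -> 0 < a -> 0 < b -> 0 < c ->
  has_law L (be_law a b c) ->
  has_cond_law X L (fun l : R => gnb_law m beta (expR (- l))) ->
  P (X @^-1` [set x]) = gnb_be_law m beta a b c [set x].
Proof.
move=> m0 b1 a0 b0 c0 lawL condX.
pose A : set R := `]0%R, +oo[%classic.
have mA : measurable A by exact: measurable_itv.
have mLA (B : set R) : measurable B -> measurable (L @^-1` B).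
  by move=> mB; rewrite -[_ @^-1` _]setTI; exact: measurable_funP.
have mX : measurable (X @^-1` [set x]).
  by rewrite -[_ @^-1` _]setTI; exact: measurable_funP.
have L0 : P (L @^-1` (~` A)) = 0%E.
  have -> : P (L @^-1` (~` A)) = be_law a b c (~` A).
    by rewrite -lawL//; exact: measurableC.
  rewrite /be_law; apply: integral0_eq => l Al; rewrite /be_pdf ifF//.
  by apply/negbTE/negP => l0; apply: Al; rewrite /A/= in_itv/= l0.
have -> : P (X @^-1` [set x]) = P (L @^-1` A `&` X @^-1` [set x]).
  rewrite setIC [LHS](@measureDI _ _ _ P _ (L @^-1` A) mX (mLA _ mA)).
  rewrite [X in (X + _)%E](_ : _ = 0%E) ?add0e//.
  apply: (@subset_measure0 _ _ _ P _ (L @^-1` (~` A))) => //.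
  - by apply: measurableD => //; exact: mLA.
  - by apply: mLA; exact: measurableC.
pose h l := (gnb_pmf m beta (expR (- l)) x)%:E.
have h0 l : A l -> (0 <= h l)%E.
  rewrite /A/= in_itv/= andbT => l0.
  by rewrite lee_fin gnb_pmf_ge0// expR_le1 oppr_le0 ltW.
have mh : measurable_fun A h.
  by apply/measurable_EFinP; exact: measurable_gnb_pmf_expR.
have hE l : A l -> gnb_law m beta (expR (- l)) [set x] = h l.
  by rewrite /A/= in_itv/= andbT => l0; rewrite gnb_law_set1// ltW.
rewrite condX//.
(* Lebesgue measure lives on the Borel structure generated by the half-open
   intervals, whose display differs from that of R. *)
have mL : measurable_fun setT (L : T -> measurableTypeR R).
  by move=> _ B mB; rewrite setTI; exact: mLA.
pose L' : {RV P >-> measurableTypeR R} := HB.pack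
  (L : T -> measurableTypeR R) (isMeasurableFun.Build _ _ _ _ _ mL).
transitivity (\int[distribution P L']_(l in A) h l)%E.
  rewrite ge0_integral_pushforward//.
    by apply: eq_integral => w; rewrite inE => /hE.
  by move=> l; rewrite inE => /h0.
have -> : (\int[distribution P L']_(l in A) h l =
    \int[lebesgue_measure]_(l in A) (h l * (be_pdf a b c l)%:E))%E.
  apply: ge0_integral_density => //.
  - by apply/measurable_EFinP; exact: measurable_be_pdf.
  - by move=> l; rewrite lee_fin be_pdf_ge0.
by apply: eq_integral => l; rewrite inE => Al; rewrite hE.
Qed.

Theorem theorem1 (R : realType) (m beta a b c : R)
    (hm : 0 < m) (hbeta : 1 <= beta) (ha : 0 < a) (hb : 0 < b) (hc : 0 < c) :
  let p (x : nat) : R :=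
    m / (m + beta * x%:R) * gbinom (m + beta * x%:R) x *
    \sum_(0 <= j < x.+1)
       'C(x, j)%:R * (-1) ^+ j *
       (Beta (b + (j%:R + m + beta * x%:R - x%:R) / c) a / Beta a b) in
  (forall x : nat, gnb_be_law m beta a b c [set x] = (p x)%:E)
  /\
  (forall (d : measure_display) (T : measurableType d) (P : probability T R)
      (L : {RV P >-> R}) (X : {RV P >-> nat}),
    has_law L (be_law a b c) ->
    has_cond_law X L (fun l : R => gnb_law m beta (expR (- l))) ->
    forall x : nat, P (X @^-1` [set x]) = (p x)%:E).
Proof.
split=> [x|d T P L X lawL condX x]; first exact: gnb_be_law_set1.
rewrite (gnb_be_mixture d T P L X _ _ _ _ _ x hm hbeta ha hb hc lawL condX).
exact: gnb_be_law_set1.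
Qed.
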